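(* For every formula $A$ of $\mathcal L$, if $A$ is valid in every minimal birelational model, then $A$ is derivable in $\mathsf{MK}$.
   Context: $\mathcal L$ is the language $A ::= p \mid \bot \mid A\wedge A \mid A\vee A \mid A\to A \mid \Box A \mid \Diamond A$ over a countable set $\mathrm{Atm}$ of propositional variables. Minimal propositional logic $\mathsf{MPL}$ is axiomatised by $A\wedge B\to A$, $A\wedge B\to B$, $A\to A\vee B$, $B\to A\vee B$, $(A\to B)\to((A\to C)\to(A\to B\wedge C))$, $(A\to C)\to((B\to C)\to(A\vee B\to C))$, $(A\to(B\to C))\to((A\to B)\to(A\to C))$, $A\to(B\to A)$, and modus ponens. $\mathsf{MK}$ extends $\mathsf{MPL}$ over $\mathcal L$ with the axioms $\Box(A\to B)\to(\Box A\to\Box B)$, $\Box(A\to B)\to(\Diamond A\to\Diamond B)$ and the rule $A/\Box A$. A minimal birelational model is a tuple $\langle W,\le,F,R,V\rangle$ with $W\neq\emptyset$, $\le$ a reflexive transitive relation on $W$, $F\subseteq W$ upward closed under $\le$, $R$ a binary relation on $W$, and $V:\mathrm{Atm}\to\mathcal P(W)$ with each $V(p)$ upward closed under $\le$. Forcing: $w\Vdash p$ iff $w\in V(p)$; $w\Vdash\bot$ iff $w\in F$; $\wedge,\vee$ pointwise; $w\Vdash B\to C$ iff for all $v\ge w$, $v\Vdash B$ implies $v\Vdash C$; $w\Vdash\Box B$ iff for all $v\ge w$ and all $u$ with $vRu$, $u\Vdash B$; $w\Vdash\Diamond B$ iff for all $v\ge w$ there is $u$ with $vRu$ and $u\Vdash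 B$. $A$ is valid in a model if it is forced at every world. *)

(* Defs.v *)
From mathcomp Require Import all_boot.

Set Implicit Arguments.
Unset Strict Implicit.
Unset Printing Implicit Defensive.

Inductive form (Atm : Type) : Type :=
  | Var (p : Atm)
  | Bot
  | And (A B : form Atm)
  | Or (A B : form Atm)
  | Imp (A B : form Atm)
  | Box (A : form Atm)
  | Dia (A : form Atm).

Arguments Bot {Atm}.

Declare Scope form_scope.
Delimit Scope form_scope with form.
Bind Scope form_scope with form.

Local Notation "A ⇒ B" := (Imp A B)
  (at level 55, right associativity) : form_scope.
Local Open Scope form_scope.

Inductive MPL_axiom (Atm : Type) : form Atm -> Prop :=
  | ax_andl A B : MPL_axiom (And A B ⇒ A)
  | ax_andr A B : MPL_axiom (And A B ⇒ B)
  | ax_orl A B : MPL_axiom (A ⇒ Or A B)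
  | ax_orr A B : MPL_axiom (B ⇒ Or A B)
  | ax_andI A B C : MPL_axiom ((A ⇒ B) ⇒ ((A ⇒ C) ⇒ (A ⇒ And B C)))
  | ax_orE A B C : MPL_axiom ((A ⇒ C) ⇒ ((B ⇒ C) ⇒ (Or A B ⇒ C)))
  | ax_S A B C : MPL_axiom ((A ⇒ (B ⇒ C)) ⇒ ((A ⇒ B) ⇒ (A ⇒ C)))
  | ax_K A B : MPL_axiom (A ⇒ (B ⇒ A)).

(* [MK A]: A is derivable in MK.  Derivations have no open assumptions, so
   necessitation applies to theorems only. *)
Inductive MK (Atm : Type) : form Atm -> Prop :=
  | MK_MPL A : MPL_axiom A -> MK A
  | MK_K_box A B : MK (Box (A ⇒ B) ⇒ (Box A ⇒ Box B))
  | MK_K_dia A B : MK (Box (A ⇒ B) ⇒ (Dia A ⇒ Dia B))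
  | MK_mp A B : MK (A ⇒ B) -> MK A -> MK B
  | MK_nec A : MK A -> MK (Box A).

(* No interaction between [acc] and [mle] is required. *)
Record birel_model (Atm : Type) : Type := BirelModel {
  world :> Type;
  world_inhabited : inhabited world;
  mle : world -> world -> Prop;
  mle_refl : forall w, mle w w;
  mle_trans : forall w v u, mle w v -> mle v u -> mle w u;
  fallible : world -> Prop;
  fallible_up : forall w v, mle w v -> fallible w -> fallible v;
  acc : world -> world -> Prop;
  valuation : Atm -> world -> Prop;
  valuation_up : forall p w v, mle w v -> valuation p w -> valuation p v
}.

Fixpoint forces (Atm : Type) (M : birel_model Atm) (w : M) (A : form Atm)
    {struct A} : Prop :=
  match A with
  | Var p => valuation p w
  | Bot => fallible w
  | And B C => forces w B /\ forces w C
  | Or B C => forces w B \/ forces w C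
  | Imp B C => forall v : M, mle w v -> forces v B -> forces v C
  | Box B => forall v : M, mle w v -> forall u : M, acc v u -> forces u B
  | Dia B => forall v : M, mle w v -> exists u : M, acc v u /\ forces u B
  end.

Definition valid_in (Atm : Type) (M : birel_model Atm) (A : form Atm) : Prop :=
  forall w : M, forces w A.

(* Main.v *)
Require Import Defs.
From mathcomp Require Import all_boot.
From mathcomp Require Import boolp classical_sets.

(** The canonical model has as worlds the segments [(Γ, U)]: [Γ] is a prime
    theory and [U] a set of prime theories containing [{B | Box B ∈ Γ}] which
    meets every [B] with [Dia B ∈ Γ].  Worlds are ordered by inclusion of their
    theories only, and [(Γ, U)] sees [(Δ, U')] when [Δ ∈ U]; a formula is forced
    at [(Γ, U)] iff it belongs to [Γ].  Since [Bot] has no special role, the set of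
    all formulas is a prime theory, so taking for [U] all prime theories
    containing [{B | Box B ∈ Γ}] always gives a segment.  To refute [Dia A ∉ Γ],
    one keeps in [U] only the theories omitting [A]; this still meets every [B]
    with [Dia B ∈ Γ] thanks to [Box (B → A) → (Dia B → Dia A)]. *)

Set Implicit Arguments.
Unset Strict Implicit.
Unset Printing Implicit Defensive.

Local Open Scope classical_set_scope.

(* Necessitation is not applied to open hypotheses, so that the deduction
   theorem holds. *)
Inductive entails (Atm : Type) (G : set (form Atm)) : form Atm -> Prop :=
  | entails_hyp A : G A -> entails G A
  | entails_MK A : MK A -> entails G A
  | entails_mp A B : entails G (Imp A B) -> entails G A -> entails G B.

Section Entailment.
Variable Atm : Type.
Implicit Types (A B C : form Atm) (G D X : set (form Atm)).

Lemma entails_axiom G A : MPL_axiom A -> entails G A.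
Proof. by move=> axA; apply/entails_MK/MK_MPL. Qed.

Lemma MK_imp_refl A : MK (Imp A A).
Proof.
have S := MK_MPL (ax_S A (Imp A A) A).
exact: MK_mp (MK_mp S (MK_MPL (ax_K _ _))) (MK_MPL (ax_K _ _)).
Qed.

Lemma entails_weakening G D A : G `<=` D -> entails G A -> entails D A.
Proof.
move=> GD; elim=> {A} [A /GD|A|A B _ DAB _ DA]; first exact: entails_hyp.
  exact: entails_MK.
exact: entails_mp DAB DA.
Qed.

Lemma entails_const G A B : entails G B -> entails G (Imp A B).
Proof. exact/entails_mp/entails_axiom/ax_K. Qed.

Lemma deduction G A B : entails (G `|` [set A]) B -> entails G (Imp A B).
Proof.
elim=> {B} [B [GB | ->]|B MKB|B C _ GABC _ GAB].
- exact/entails_const/entails_hyp.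
- exact/entails_MK/MK_imp_refl.
- exact/entails_const/entails_MK.
- exact: entails_mp (entails_mp (entails_axiom _ (ax_S _ _ _)) GABC) GAB.
Qed.

(** Along the derivation, necessitation boxes the theorems of [MK], and [MK_K_box] carries modus
    ponens under [Box]. *)
Lemma entails_box G A :
  entails [set B | G (Box B)] A -> entails G (Box A).
Proof.
elim=> {A} [A GA|A MKA|A B _ GAB _ GA].
- exact: entails_hyp.
- exact/entails_MK/MK_nec.
- exact: entails_mp (entails_mp (entails_MK _ (MK_K_box _ _)) GAB) GA.
Qed.

(** A derivation uses finitely many hypotheses, and finitely many members of a chain lie in the
    largest of them. The first alternative covers the empty chain. *)
Lemma entails_bigcup_chain (F : set (set (form Atm))) G C :
  total_on F subset -> entails (G `|` \bigcup_(X in F) X) C ->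
  entails G C \/ exists2 X, F X & entails (G `|` X) C.
Proof.
move=> totF; elim=> {C} [A [GA|[X FX XA]]|A MKA|A B _ IHAB _ IHA].
- by left; apply: entails_hyp.
- by right; exists X => //; apply: entails_hyp; right.
- by left; apply: entails_MK.
case: IHAB IHA => [GAB|[X FX XAB]] [GA|[Y FY YA]].
- by left; apply: entails_mp GAB GA.
- right; exists Y => //; apply: entails_mp YA.
  exact: entails_weakening GAB.
- right; exists X => //; apply: (entails_mp XAB).
  exact: entails_weakening GA.
- case: (totF _ _ FX FY) => [XY|YX].
    right; exists Y => //; apply: entails_mp YA.
    by apply: entails_weakening XAB; apply: setUS.
  right; exists X => //; apply: (entails_mp XAB).
  by apply: entails_weakening YA; apply: setUS.
Qed.

Definition prime_theory G : Prop :=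
  (forall A, entails G A -> G A) /\ (forall A B, G (Or A B) -> G A \/ G B).

Lemma prime_theory_setT : prime_theory setT.
Proof. by split=> // A B _; left. Qed.

(** Once the theory is maximal among those not entailing [C], every formula outside it implies [C]
    over it; closure then follows by modus ponens and primeness by [ax_orE]. *)
Lemma lindenbaum G C :
  ~ entails G C -> exists D, [/\ prime_theory D, G `<=` D & ~ D C].
Proof.
move=> GC.
(* Maximizing the added part [X] instead of a superset of [G] makes the empty union an admissible
   bound for the empty chain. *)
have [F FP totF|X [XC maxX]] := @Zorn_bigcup _ [set X | ~ entails (G `|` X) C].
  by case/(entails_bigcup_chain totF) => [/GC//|[X /FP]].
have impC A : ~ (G `|` X) A -> entails (G `|` X) (Imp A C).
  move=> nA; apply/deduction; rewrite -setUA; apply: contrapT => nC.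
  apply: (maxX (X `|` [set A])) nC; split=> [|sub]; first exact: subsetUl.
  by apply: nA; right; apply: sub; right.
exists (G `|` X); split; last by move=> /(@entails_hyp _ _ _).
- split=> [A XA|A B XAB].
    by apply: contrapT => /impC XAC; apply/XC/(entails_mp XAC XA).
  apply: contrapT => /not_orP[/impC XAC /impC XBC]; apply: XC.
  apply: entails_mp (entails_hyp XAB).
  exact: entails_mp (entails_mp (entails_axiom _ (ax_orE _ _ _)) XAC) XBC.
- exact: subsetUl.
Qed.

Section PrimeTheory.
Variables (G : set (form Atm)) (primeG : prime_theory G).

Lemma prime_theory_MK A : MK A -> G A.
Proof. by move=> MKA; apply/primeG.1/entails_MK. Qed.

Lemma prime_theory_mp A B : G (Imp A B) -> G A -> G B.
Proof.
by move=> GAB GA; apply/primeG.1/(entails_mp (entails_hyp GAB))/entails_hyp.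
Qed.

Lemma prime_theory_mp_MK A B : MK (Imp A B) -> G A -> G B.
Proof. by move/prime_theory_MK; apply: prime_theory_mp. Qed.

Lemma prime_theory_and A B : G (And A B) <-> G A /\ G B.
Proof.
split=> [GAB|[GA GB]].
  by split; apply: prime_theory_mp_MK GAB; apply: MK_MPL; constructor.
apply: primeG.1.
apply: (@entails_mp _ _ A); last exact: entails_hyp.
apply: entails_mp (entails_const _ (entails_hyp GB)).
apply: entails_mp (entails_axiom _ (ax_andI _ _ _)) _.
exact/entails_MK/MK_imp_refl.
Qed.

Lemma prime_theory_or A B : G (Or A B) <-> G A \/ G B.
Proof.
split=> [|[]]; first exact: primeG.2.
  exact/prime_theory_mp_MK/MK_MPL/ax_orl.
exact/prime_theory_mp_MK/MK_MPL/ax_orr.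
Qed.

Lemma prime_theory_imp A B :
  (forall D, prime_theory D -> G `<=` D -> D A -> D B) -> G (Imp A B).
Proof.
move=> GAB; apply/primeG.1/deduction.
apply: contrapT => /lindenbaum[D [primeD GD]].
by apply; apply: GAB => // [C GC|]; apply: GD; [left|right].
Qed.

Lemma prime_theory_box A :
  (forall D, prime_theory D -> [set B | G (Box B)] `<=` D -> D A) -> G (Box A).
Proof.
move=> GA; apply/primeG.1/entails_box.
apply: contrapT => /lindenbaum[D [primeD GD]].
by apply; apply: GA.
Qed.

(** If [B] and the unboxed formulas of [G] entailed [A], then [Box (Imp B A)] would be in [G], and
    [MK_K_dia] would put [Dia A] there. *)
Lemma prime_theory_dia A B : G (Dia B) -> ~ G (Dia A) ->
  exists D, [/\ prime_theory D, [set C | G (Box C)] `<=` D, D B & ~ D A].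
Proof.
move=> GB GA.
have [|D [primeD GD DA]] := @lindenbaum ([set C | G (Box C)] `|` [set B]) A.
  move=> /deduction /entails_box /primeG.1 GBA; apply: GA.
  exact: prime_theory_mp (prime_theory_mp_MK (MK_K_dia _ _) GBA) GB.
by exists D; split=> // [C GC|]; apply: GD; [left|right].
Qed.

End PrimeTheory.
End Entailment.

(** Successors are theories and not segments, which avoids circularity; each stands for all segments
    carrying that theory. *)
Record segment (Atm : Type) : Type := Segment {
  theory : set (form Atm);
  successors : set (set (form Atm));
  theory_prime : prime_theory theory;
  successors_prime : successors `<=` @prime_theory Atm;
  successors_box :
    forall D, successors D -> [set B | theory (Box B)] `<=` D;
  successors_dia : forall B, theory (Dia B) -> exists2 D, successors D & D B
}.

Section CanonicalModel.
Variable Atm : Type.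
Implicit Types (A B : form Atm) (G : set (form Atm)) (w v : segment Atm).

Definition full_segment G (primeG : prime_theory G) : segment Atm.
Proof.
exists G [set D | prime_theory D /\ [set B | G (Box B)] `<=` D] => //.
- by move=> D [].
- by move=> D [].
- by move=> B _; exists setT => //; split=> //; apply: prime_theory_setT.
Defined.

Definition omitting_segment G (primeG : prime_theory G) A
  (GA : ~ G (Dia A)) : segment Atm.
Proof.
exists G
  [set D | [/\ prime_theory D, [set B | G (Box B)] `<=` D & ~ D A]] => //.
- by move=> D [].
- by move=> D [].
- by move=> B GB; have [D []] := prime_theory_dia primeG GB GA; exists D.
Defined.

Definition canonical_model : birel_model Atm.
Proof.
refine (@BirelModel Atm (segment Atm)
  (inhabits (full_segment (@prime_theory_setT Atm)))
  (fun w v => theory w `<=` theory v) _ _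
  (fun w => theory w Bot) _
  (fun w v => successors w (theory v))
  (fun p w => theory w (Var p)) _).
- by move=> w; apply: subset_refl.
- by move=> w v u; apply: subset_trans.
- by move=> w v; apply.
- by move=> p w v; apply.
Defined.

Lemma truth_lemma A (w : canonical_model) : forces w A <-> theory w A.
Proof.
elim: A w => [p||A IHA B IHB|A IHA B IHB|A IHA B IHB|A IHA|A IHA] w //=;
  have primew := theory_prime w.
- by rewrite (prime_theory_and primew) IHA IHB.
- by rewrite (prime_theory_or primew) IHA IHB.
- split=> [wAB|wAB v wv /IHA vA].
    apply: (prime_theory_imp primew) => D primeD wD DA.
    by apply/(IHB (full_segment primeD))/wAB => //; apply/IHA.
  by apply/IHB/(prime_theory_mp (theory_prime v) _ vA)/wv.
- split=> [wA|wA v wv u vu].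
    apply: (prime_theory_box primew) => D primeD wD.
    (* [w] itself may not see [D], but the full segment on the theory of [w] lies above [w] and
       does. *)
    by apply/(IHA (full_segment primeD))/(wA (full_segment primew)).
  by apply/IHA/(successors_box vu)/wv.
- split=> [wA|wA v /(_ _ wA) /successors_dia[D vD DA]].
    apply: contrapT => nA.
    (* The omitting segment has the same theory as [w], hence lies above it, yet none of its
       successors contains [A]. *)
    have [//|u [[_ _ uA]]] := wA (omitting_segment primew nA).
    by move/IHA.
  by exists (full_segment (successors_prime vD)); split=> //; apply/IHA.
Qed.

End CanonicalModel.

Theorem mainTheorem3 (Atm : countType) (A : form Atm) :
  (forall M : birel_model Atm, valid_in M A) -> MK A.
Proof.
move=> validA.
have : entails set0 A.
  apply: contrapT => /lindenbaum[D [primeD _]]; apply.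
  by apply/(truth_lemma A (full_segment primeD))/validA.
by elim=> {validA A} // A B _ MKAB _; apply: MK_mp.
Qed.
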